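(* For every integer $k\geq 3$ there exists a positive integer $N$ such that for all $n\geq N$, every permutation $p\in S_n$ has a subsequence $(x_1,x_2,\ldots,x_k)$ of length $k$ such that $x_1+x_2+\cdots+x_k=2x_1$ or $x_1+x_2+\cdots+x_k=2x_k$.
   Context: $S_n$ denotes the set of permutations of $\{1,2,\ldots,n\}$ written in one-line notation $p=(p_1,p_2,\ldots,p_n)$. A subsequence of $p$ of length $k$ is a sequence $(p_{i_1},p_{i_2},\ldots,p_{i_k})$ with $i_1<i_2<\cdots<i_k$ (not necessarily consecutive positions). *)

(* Defs.v *)
From mathcomp Require Import all_boot all_fingroup.

Set Implicit Arguments.
Unset Strict Implicit.
Unset Printing Implicit Defensive.

(* 'S_n acts on {0, ..., n-1}; positions and values are shifted by one so that
   the word (p_1, ..., p_n) has entries in {1, ..., n}. *)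
Definition one_line (n : nat) (p : 'S_n) : seq nat :=
  [seq (p i).+1 | i <- enum 'I_n].

(* Main.v *)
Require Import Defs.
From mathcomp Require Import all_boot all_fingroup.
From mathcomp Require Import zify.

(** Everything happens at the first [k - 1] entries of the one-line word of the
    permutation.

    If the entry [v] at one of these positions is large, then [v] is a sum of
    [k - 1] distinct positive integers that avoid the entries to its left
    ([sum_of_distinct_avoiding]).  As [k - 1 >= 2], these summands are smaller
    than [v], so they all occur in the word, to the right of [v]; listed in
    their order of occurrence after [v], they give a subsequence whose first
    entry is the sum of the others.  Hence, unless a subsequence of the required
    kind exists, the first [k - 1] entries are bounded by a constant that depends
    on [k] only ([end_sum_or_bounded_prefix]).

    Their sum [s] is then at most [n] once [n] is large, so it occurs in the
    word.  It exceeds each of the [k - 1] entries, so it occurs to their right,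
    and the first [k - 1] entries followed by [s] form a subsequence whose last
    entry is the sum of the others. *)

Lemma mem_lt_sum (s : seq nat) y :
  1 < size s -> all (leq 1) s -> y \in s -> y < \sum_(z <- s) z.
Proof.
move=> s_gt1 s_pos ys; rewrite (big_rem y) //=.
have: all (leq 1) (rem y s) by apply/allP=> z /mem_rem; apply: (allP s_pos).
have: 0 < size (rem y s) by rewrite size_rem // -subn1 subn_gt0.
case: (rem y s) => [|z t] //= _ /andP[z_gt0 _]; rewrite big_cons; lia.
Qed.

Lemma sum_le_bound (s : seq nat) B :
  all (leq^~ B) s -> \sum_(y <- s) y <= size s * B.
Proof.
elim: s => [|y s IHs] /=; first by rewrite big_nil.
by case/andP=> yB /IHs sB; rewrite big_cons mulSn leq_add.
Qed.

Lemma fresh_seq (F : seq nat) m :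
  exists S : seq nat,
    [/\ uniq S, size S = m & {in S, forall y, 0 < y <= m + size F /\ y \notin F}].
Proof.
set I := iota 1 (m + size F).
set G := [seq y <- I | y \notin F].
have uI : uniq I by apply: iota_uniq.
have sG : m <= size G.
  have FI : size [seq y <- I | y \in F] <= size F.
    apply: uniq_leq_size; first exact: filter_uniq.
    by move=> y; rewrite mem_filter => /andP[].
  have GF : size [seq y <- I | y \in F] + size G = size I.
    by rewrite !size_filter; apply: count_predC.
  by move: GF FI; rewrite size_iota; lia.
exists (take m G); split.
- exact/take_uniq/filter_uniq.
- exact: size_takel.
- move=> y /mem_take; rewrite mem_filter mem_iota => /andP[yF yI].
  by split=> //; move: yI; lia.
Qed.

(** All summands but one are the smallest integers outside [F]; the last one is
    whatever remains of [v], which is too large to lie in [F] or to repeat one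
    of the small summands. *)
Lemma sum_of_distinct_avoiding (F : seq nat) C m v :
  all (leq^~ C) F -> C + m.+1 * (m + size F) < v ->
  exists S : seq nat,
    [/\ uniq S, size S = m.+1, all (leq 1) S,
        {in S, forall y, y \notin F} & \sum_(y <- S) y = v].
Proof.
move=> FC v_big; have [A [uA sA Ain]] := fresh_seq F m.
have A_le : \sum_(y <- A) y <= m * (m + size F).
  by rewrite -sA sum_le_bound //; apply/allP=> y /Ain[/andP[_]]; rewrite sA.
rewrite mulSn in v_big.
set r := v - \sum_(y <- A) y.
have r_big : C + (m + size F) < r by rewrite /r; lia.
exists (r :: A); split=> /=.
- by rewrite uA andbT; apply/negP=> /Ain[/andP[_ rB] _]; lia.
- by rewrite sA.
- by rewrite (leq_ltn_trans _ r_big) //; apply/allP=> y /Ain[/andP[]].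
- move=> y; rewrite inE => /predU1P[-> | /Ain[] //].
  by apply/negP=> /(allP FC) /= rC; lia.
- by rewrite big_cons /r; lia.
Qed.

Definition has_end_sum (k : nat) (w : seq nat) : Prop :=
  exists x : seq nat,
    [/\ subseq x w, size x = k &
        \sum_(y <- x) y = 2 * head 0 x \/ \sum_(y <- x) y = 2 * last 0 x].

Lemma has_end_sum_before (u t S : seq nat) v :
  uniq t -> uniq S -> {subset S <= t} -> \sum_(y <- S) y = v ->
  has_end_sum (size S).+1 (u ++ v :: t).
Proof.
move=> ut uS St Sv; set X := [seq y <- t | y \in S].
have XS : perm_eq X S.
  apply: uniq_perm => //; first exact: filter_uniq.
  by move=> y; rewrite mem_filter andb_idr //; apply: St.
exists (v :: X); split.
- by rewrite (subseq_trans _ (suffix_subseq _ _)) //= eqxx filter_subseq.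
- by rewrite /= (perm_size XS).
- by left; rewrite big_cons (perm_big _ XS) Sv /= mul2n addnn.
Qed.

Lemma has_end_sum_after (u t : seq nat) v :
  v \in t -> \sum_(y <- u) y = v -> has_end_sum (size u).+1 (u ++ t).
Proof.
move=> vt uv; exists (rcons u v); split; last 1 first.
- by right; rewrite big_rcons last_rcons uv /= mul2n addnn.
- by rewrite -cats1 cat_subseq ?sub1seq.
- by rewrite size_rcons.
Qed.

(** The bound grows linearly with the length of the prefix because the summands
    used for the next entry have to avoid all previous entries, and the large
    one among them does so by exceeding the previous bound. *)
Lemma end_sum_or_bounded_prefix n m (w : seq nat) i :
  perm_eq w (iota 1 n) -> 0 < m -> i <= m.+1 -> i <= size w ->
  has_end_sum m.+2 w \/ all (leq^~ (i * (m.+1 * (m + m)))) (take i w).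
Proof.
move=> wn m_gt0; set D := m.+1 * (m + m).
have uw : uniq w by rewrite (perm_uniq wn) iota_uniq.
elim: i => [|i IHi] i_le iw; first by right; rewrite take0.
have [|FC] := IHi (ltnW i_le) (ltnW iw); first by left.
set F := take i w in FC; set v := nth 0 w i; set t := drop i.+1 w.
have Dw : w = F ++ v :: t by rewrite -drop_nth // cat_take_drop.
have [v_le | v_gt] := leqP v (i.+1 * D).
  right; rewrite (take_nth 0) // all_rcons v_le.
  by apply: sub_all FC => y /= /leq_trans; apply; rewrite leq_mul2r leqnSn orbT.
left.
have v_big : i * D + m.+1 * (m + size F) < v.
  have D_le : m.+1 * (m + size F) <= D.
    by rewrite leq_mul2l leq_add2l size_takel ?(ltnW iw).
  by rewrite (leq_ltn_trans _ v_gt) // mulSn addnC leq_add2r.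
have [S [uS sS S_pos SF Sv]] := sum_of_distinct_avoiding _ _ _ _ FC v_big.
have S_gt1 : 1 < size S by rewrite sS.
rewrite -sS Dw; apply: has_end_sum_before => //; first exact: drop_uniq.
move=> y yS.
have y_lt : y < v by rewrite -Sv; apply: mem_lt_sum.
have y_w : y \in w.
  have: v \in w by apply: mem_nth.
  rewrite !(perm_mem wn) !mem_iota => /andP[_ v_le].
  by rewrite (allP S_pos) //= (ltn_trans y_lt).
move: y_w; rewrite {1}Dw mem_cat inE (negPf (SF y yS)) /=.
by case/predU1P=> // yv; move: y_lt; rewrite yv ltnn.
Qed.

Lemma one_line_perm n (p : 'S_n) : perm_eq (one_line p) (iota 1 n).
Proof.
apply: uniq_perm; last 1 first.
- move=> y; rewrite mem_iota add1n ltnS; apply/mapP/andP=> [[i _ ->] | []].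
    by rewrite ltn_ord.
  case: y => // y _ y_lt; exists ((p^-1)%g (Ordinal y_lt)).
    by rewrite mem_enum.
  by rewrite permKV.
- by rewrite map_inj_uniq ?enum_uniq // => i j [/val_inj/perm_inj].
- exact: iota_uniq.
Qed.

Theorem theorem1p1 (k : nat) (hk : 3 <= k) :
  exists2 N : nat, 0 < N &
    forall (n : nat) (p : 'S_n), N <= n ->
      exists x : seq nat,
        [/\ subseq x (one_line p), size x = k &
            \sum_(y <- x) y = 2 * head 0 x \/
            \sum_(y <- x) y = 2 * last 0 x].
Proof.
case: k hk => [|[|m]] //; rewrite !ltnS => m_gt0.
(* N bounds the sum of m+1 entries, each at most C, so that this sum occurs in
   the word; it is also at least m+1, so that a prefix of length m+1 exists. *)
set C := m.+1 * (m.+1 * (m + m)); exists (m.+1 * C); first by rewrite /C; lia.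
move=> n p n_big; rewrite -/(has_end_sum m.+2 (one_line p)).
have wn := one_line_perm _ p; set w := one_line p in wn *.
have sw : m.+1 <= size w.
  rewrite (perm_size wn) size_iota (leq_trans _ n_big) // leq_pmulr // /C; lia.
have [//|FC] := end_sum_or_bounded_prefix _ _ _ _ wn m_gt0 (leqnn _) sw.
set F := take m.+1 w in FC; set s := \sum_(y <- F) y.
have sF : size F = m.+1 by apply: size_takel.
have F_gt1 : 1 < size F by rewrite sF.
have F_pos : all (leq 1) F.
  by apply/allP=> y /mem_take; rewrite (perm_mem wn) mem_iota => /andP[].
have Fs y : y \in F -> y < s by apply: mem_lt_sum.
have s_le : s <= n.
  by rewrite (leq_trans (sum_le_bound _ _ FC)) // sF.
have s_w : s \in w.
  have F0 : nth 0 F 0 \in F by apply: mem_nth; rewrite sF.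
  by rewrite (perm_mem wn) mem_iota add1n ltnS s_le (leq_ltn_trans _ (Fs _ F0)).
have s_F : s \notin F by apply/negP=> /Fs; rewrite ltnn.
rewrite -(cat_take_drop m.+1 w) -/F -sF; apply: has_end_sum_after => //.
by move: s_w; rewrite -{1}(cat_take_drop m.+1 w) mem_cat -/F (negPf s_F) sF.
Qed.
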